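(* Let $(C,\phi)$ be a multistate monotone system with component state sets $\mathcal{S}_i=\{0,1,\ldots,m_i\}$, $m_i\ge1$, let $k\in\{1,\ldots,M\}$ and $e\in C$. Then $$d(\phi_k)=d(\phi_k((m_e)_e,\cdot))-d(\phi_k((m_e-1)_e,\cdot)),$$ where $\phi_k((r)_e,\cdot)$ denotes the binary-valued non-decreasing function on $\prod_{i\in C\setminus\{e\}}\mathcal{S}_i$ obtained from $\phi_k$ by fixing the state of component $e$ to $r$, regarded as the $1$-level structure function of a multistate monotone system with component set $C\setminus\{e\}$.
   Context: A multistate monotone system (MMS) $(C,\phi)$ has component set $C$ (finite, $n=|C|$), component state sets $\mathcal{S}_i=\{0,1,\ldots,m_i\}$, component state space $\mathfrak{C}=\prod_{i\in C}\mathcal{S}_i$, system state set $\{0,1,\ldots,M\}$, and a structure function $\phi:\mathfrak{C}\to\{0,\ldots,M\}$ non-decreasing in each argument; $\phi_k(\bm{x})=\mathrm{I}(\phi(\bm{x})\ge k)$. Vectors are ordered componentwise. A minimal $k$-level path vector is $\bm{x}\in\mathfrak{C}$ with $\phi(\bm{x})\ge k$ and $\phi(\bm{y})<k$ for all $\bm{y}\le\bm{x}$, $\bm{y}\ne\bm{x}$; $\mathfrak{P}_k$ is the set of these, and $\mathrm{cl}(\mathfrak{P}_k)$ is the smallest set containing $\mathfrak{P}_k$ closed under componentwise maximum $\vee$. A formation of $\bm{x}\in\mathrm{cl}(\mathfrak{P}_k)$ is a nonempty subset $\{\bm{x}_{i_1},\ldots,\bm{x}_{i_j}\}\subseteq\mathfrak{P}_k$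 with $\bm{x}=\bm{x}_{i_1}\vee\cdots\vee\bm{x}_{i_j}$, odd/even according to parity of $j$. $\delta_k(\bm{x})=$ (number of odd formations) $-$ (number of even formations) for $\bm{x}\in\mathrm{cl}(\mathfrak{P}_k)$, $\delta_k(\bm{x})=0$ otherwise. The signed domination of $\phi_k$ is $d(\phi_k)=\delta_k(\bm{m})$, with $\bm{m}$ the vector of maximal states $(m_i)_{i\in C}$. The same definitions apply to the restricted systems on $C\setminus\{e\}$ (with maximal vector $(m_i)_{i\ne e}$; if $C\setminus\{e\}=\emptyset$ the state space is a single point, and $d$ equals the constant value of the function). *)

(* Defs.v *)
From mathcomp Require Import all_boot all_order all_algebra.

Set Implicit Arguments.
Unset Strict Implicit.
Unset Printing Implicit Defensive.

Import Order.TTheory GRing.Theory Num.Theory.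

Section StateVectors.
Variables (C : finType) (m : C -> nat).

Definition state := {dffun forall i : C, 'I_(m i).+1}.

Definition le_state (x y : state) : bool := [forall i, x i <= y i].

Definition join_state (x y : state) : state :=
  [ffun i : C => Order.max (x i) (y i) : 'I_(m i).+1].

Definition bot_state : state := [ffun i : C => ord0 : 'I_(m i).+1].

Definition top_state : state := [ffun i : C => ord_max : 'I_(m i).+1].

(* [bot_state] is neutral for [join_state], so for nonempty [A] this is the
   join of the elements of [A]. *)
Definition join_set (A : {set state}) : state :=
  \big[join_state/bot_state]_(x in A) x.

Definition join_closed (A : {set state}) : bool :=
  [forall x in A, forall y in A, join_state x y \in A].

Definition join_closure (P : {set state}) : {set state} :=
  \bigcap_(A : {set state} | (P \subset A) && join_closed A) A.

Definition nondecreasing_each (f : state -> nat) : Prop :=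
  forall (i : C) (x y : state),
    (forall j, j != i -> x j = y j) -> x i <= y i -> f x <= f y.

End StateVectors.

Record mms (C : finType) (m : C -> nat) (M : nat) := MMS {
  struct_fun :> state m -> 'I_M.+1;
  struct_fun_mono : nondecreasing_each struct_fun
}.

Section Domination.
Variables (C : finType) (m : C -> nat) (M : nat) (phi : mms m M) (k : nat).

(* The 0/1-valued function phi_k, as a boolean. *)
Definition level_fun (x : state m) : bool := k <= phi x.

Definition min_path_vectors : {set state m} :=
  [set x | (k <= phi x) &&
           [forall y, le_state y x && (y != x) ==> (phi y < k)]].

Definition formations (x : state m) : {set {set state m}} :=
  [set A : {set state m} |
    [&& A != set0, A \subset min_path_vectors & x == join_set A]].

Definition delta (x : state m) : int :=
  if x \in join_closure min_path_vectors then
    (#|[set A in formations x | odd #|A| ]|%:Z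
     - #|[set A in formations x | ~~ odd #|A| ]|%:Z)%R
  else 0%R.

Definition signed_domination : int := delta (top_state m).

End Domination.

Section FixComponent.
Variables (C : finType) (m : C -> nat) (e : C).

Definition others : finType := {i : C | i != e}.

Definition m_others (i : others) : nat := m (val i).

Definition extend (r : 'I_(m e).+1) (y : state m_others) : state m :=
  [ffun i : C =>
    match eqVneq i e return 'I_(m i).+1 with
    | EqNotNeq ie => cast_ord (congr1 (fun j => (m j).+1) (esym ie)) r
    | NeqNotEq ie => y (Sub i ie)
    end].

Lemma extend_e (r : 'I_(m e).+1) (y : state m_others) : extend r y e = r.
Proof.
rewrite ffunE; case: eqVneq => [ie|]; first exact/val_inj.
by move=> ne; case/eqP: (ne).
Qed.

Lemma extend_val (r : 'I_(m e).+1) (y : state m_others) (i : others) :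
  extend r y (val i) = y i.
Proof.
rewrite ffunE; case: i => i ie /=; case: eqVneq => [eq_ie | ne].
  by case/eqP: (ie).
by rewrite (bool_irrelevance ie ne).
Qed.

Variables (M : nat) (phi : mms m M) (k : nat) (r : 'I_(m e).+1).

(* phi_k (r_e, y), coerced from bool to the state set {0, 1} = 'I_2. *)
Definition fix_fun (y : state m_others) : 'I_2 :=
  inord (level_fun phi k (extend r y)).

Lemma fix_fun_mono : nondecreasing_each fix_fun.
Proof.
move=> i x y xy le_xy; rewrite /fix_fun !inordK; do ?by case: level_fun.
have le_phi : phi (extend r x) <= phi (extend r y).
  apply: (@struct_fun_mono _ _ _ phi (val i)); last by rewrite !extend_val.
  move=> j ji; have [-> | je] := eqVneq j e; first by rewrite !extend_e.
  rewrite -[j]/(val (Sub j je : others)) !extend_val; apply: xy.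
  by rewrite -val_eqE.
rewrite /level_fun; case: (boolP (k <= phi (extend r x))) => // le_k.
by rewrite (leq_trans le_k le_phi).
Qed.

Definition fix_component : mms m_others 1 := MMS fix_fun_mono.

End FixComponent.

(* Main.v *)
Require Import Defs.
From mathcomp Require Import all_boot all_order all_algebra.

(** By inclusion-exclusion over the minimal path vectors below [x], the sum of
    [delta phi k y] over [y <= x] is [phi_k x]; hence [delta phi k] is the
    Moebius inverse of [phi_k] for the componentwise order, and it is determined
    by this property. Fixing component [e] to [r] therefore gives
    [delta (phi_k (r_e, .)) y = \sum_(s <= r) delta phi k (s_e, y)], and the
    difference of the cases [r = m_e] and [r = m_e - 1] at the top vector is the
    single term [s = m_e], which is [d (phi_k)]. *)

Set Implicit Arguments.
Unset Strict Implicit.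
Unset Printing Implicit Defensive.

Import Order.TTheory GRing.Theory.

(** Expand the product of [F i + 1] over all [i]: subsets not inside [Q] contribute 0 and the others
    their sign, while any [q] in [Q] makes a factor vanish. *)
Lemma sum_subset_sign (T : finType) (Q : {set T}) : Q != set0 ->
  (\sum_(A : {set T} | A \subset Q) (-1) ^+ #|A| = 0 :> int)%R.
Proof.
case/set0Pn=> q qQ.
pose F (i : T) : int := if i \in Q then (-1)%R else 0%R.
transitivity (\prod_i (F i + 1))%R; last first.
  by rewrite (bigD1 q) //= /F qQ addNr mul0r.
rewrite bigA_distr big_mkcond; apply: eq_bigr => A _.
rewrite -big_mkcond /=; case: ifPn => [AQ | /subsetPn[i iA iQ]].
  rewrite (eq_bigr (fun _ => (-1)%R)) ?prodr_const // => i iA.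
  by rewrite /F (subsetP AQ).
by rewrite (bigD1 i) //= /F (negPf iQ) mul0r.
Qed.

Section Order.
Variables (C : finType) (m : C -> nat).
Implicit Types (x y z : state m) (A : {set state m}).

Lemma le_state_refl x : le_state x x.
Proof. exact/forallP. Qed.

Lemma le_state_trans y x z : le_state x y -> le_state y z -> le_state x z.
Proof.
move=> /forallP xy /forallP yz; apply/forallP=> i.
exact: leq_trans (xy i) (yz i).
Qed.

Lemma le_state_anti x y : le_state x y -> le_state y x -> x = y.
Proof.
move=> /forallP xy /forallP yx; apply/ffunP=> i; apply/val_inj/eqP.
by rewrite eqn_leq xy yx.
Qed.

Lemma join_stateE x y i : join_state x y i = maxn (x i) (y i) :> nat.
Proof.
rewrite ffunE maxEle; case: (leqP (x i) (y i)) => xy; first by rewrite ifT.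
by rewrite ifF //; apply/negbTE; rewrite -ltnNge.
Qed.

Lemma join_state_le x y z :
  le_state (join_state x y) z = le_state x z && le_state y z.
Proof.
apply/forallP/andP => [xyz | [/forallP xz /forallP yz] i].
  by split; apply/forallP=> i; move: (xyz i);
    rewrite join_stateE geq_max => /andP[].
by rewrite join_stateE geq_max xz yz.
Qed.

Lemma join_set_le A z : le_state (join_set A) z = [forall x in A, le_state x z].
Proof.
rewrite /join_set (big_morph (fun x => le_state x z) (id1 := true) (op1 := andb)).
- by rewrite big_andE.
- by move=> x y; rewrite join_state_le.
- by apply/forallP=> i; rewrite ffunE.
Qed.

(** Shows that no state outside the closure has a formation, so the default value 0 in [delta]
    agrees with the signed count of formations. *)
Lemma join_set_closure (P A : {set state m}) :
  A != set0 -> A \subset P -> join_set A \in join_closure P.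
Proof.
case/set0Pn=> a aA AP; apply/bigcapP=> B /andP[PB /'forall_in_forall_inP clB].
have AB x : x \in A -> x \in B by move/(subsetP AP)/(subsetP PB).
have joinE : join_set A = join_state a (join_set A).
  have: le_state (join_set A) (join_set A) by apply: le_state_refl.
  rewrite join_set_le => /'forall_in_idP/(_ a aA)/forallP a_le.
  apply/ffunP=> i; apply/val_inj/esym; rewrite /= join_stateE.
  exact/maxn_idPr/a_le.
have join0 x : join_state x (bot_state m) = x.
  by apply/ffunP=> i; apply/val_inj; rewrite /= join_stateE ffunE maxn0.
(* [bot_state] need not lie in [B], so the induction carries it as an alternative; in that case
   [joinE] collapses the join to [a], which is in [B]. *)
have: join_set A = bot_state m \/ join_set A \in B.
  apply: (big_ind (fun x => x = bot_state m \/ x \in B)) => [|x y|x xA].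
  - by left.
  - case=> [->|xB] [->|yB]; rewrite ?join0; [by left | right | by right |].
      suff -> : join_state (bot_state m) y = y by [].
      by apply/ffunP=> i; apply/val_inj; rewrite /= join_stateE ffunE max0n.
    by right; apply: clB.
  - by right; apply: AB.
case=> [bot|//]; rewrite joinE bot join0; exact: AB.
Qed.

Lemma card_down_lt x y : le_state y x -> y != x ->
  #|[set z | le_state z y]| < #|[set z | le_state z x]|.
Proof.
move=> yx neq; apply/proper_card/properP; split.
  by apply/subsetP=> z; rewrite !inE => /le_state_trans; apply.
exists x; rewrite !inE ?le_state_refl //; apply: contra neq => xy.
exact/eqP/le_state_anti.
Qed.

Lemma state_ind (K : state m -> Prop) :
  (forall x, (forall y, le_state y x -> y != x -> K y) -> K x) ->
  forall x, K x.
Proof.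
move=> IH x; have [n] := ubnP #|[set z | le_state z x]|.
elim: n x => // n IHn x le_n; apply: IH => y yx neq.
exact/IHn/(leq_trans (card_down_lt yx neq)).
Qed.

(** By induction along the order, the terms strictly below [x] agree and cancel, leaving
    [F x = G x]. *)
Lemma moebius_uniq (V : zmodType) (F G : state m -> V) :
  (forall x, \sum_(y | le_state y x) F y = \sum_(y | le_state y x) G y)%R ->
  F =1 G.
Proof.
move=> FG; elim/state_ind=> x IH; move: (FG x).
rewrite (bigD1 x) ?le_state_refl //= [RHS](bigD1 x) ?le_state_refl //=.
rewrite (eq_bigr G) => [|y /andP[]]; [exact: addIr | exact: IH].
Qed.

End Order.

Section Delta.
Variables (C : finType) (m : C -> nat) (M : nat) (phi : mms m M) (k : nat).
Implicit Types (x y : state m) (A : {set state m}).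

Lemma struct_fun_le x y : le_state x y -> phi x <= phi y.
Proof.
(* [w s] agrees with [y] on [s] and with [x] elsewhere; coordinates are switched
   from [x] to [y] one at a time. *)
move=> /forallP xy.
pose w (s : seq C) : state m := [ffun i => if i \in s then y i else x i].
have w_le s : phi x <= phi (w s).
  elim: s => [|i s IHs].
    by suff -> : w [::] = x by []; apply/ffunP=> j; rewrite ffunE.
  apply: leq_trans IHs _; apply: (@struct_fun_mono _ _ _ phi i) => [j ji|].
    by rewrite !ffunE inE (negPf ji).
  by rewrite !ffunE mem_head; case: ifP.
suff <- : w (enum C) = y by [].
by apply/ffunP=> j; rewrite ffunE mem_enum.
Qed.

(** Descent: a state reaching level [k] that is not minimal has a strictly smaller state still
    reaching [k]. *)
Lemma min_path_vector_below x : k <= phi x ->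
  exists2 p, p \in min_path_vectors phi k & le_state p x.
Proof.
elim/state_ind: x => x IH kx.
have [xP | ] := boolP (x \in min_path_vectors phi k).
  by exists x; rewrite ?le_state_refl.
rewrite inE kx /= => /forallPn[y]; rewrite negb_imply -leqNgt.
case/andP=> /andP[yx neq] ky; have [p pP py] := IH y yx neq ky.
by exists p => //; apply: le_state_trans yx.
Qed.

(** An odd formation has sign -1 but counts +1 in [delta], hence the outer minus. *)
Lemma delta_sign x :
  (delta phi k x = - \sum_(A in formations phi k x) (-1) ^+ #|A|)%R.
Proof.
rewrite /delta; case: ifPn => [_|xP]; last first.
  rewrite big_pred0 ?oppr0 // => A; apply: contraNF xP.
  by rewrite inE => /and3P[A0 AP /eqP->]; apply: join_set_closure.
rewrite (bigID (fun A => odd #|A|)) /= opprD; congr (_ + _)%R.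
  rewrite (eq_bigr (fun _ => (-1)%R)) => [|A /andP[_ oddA]].
    by rewrite sumrN opprK sumr_const cardsE natz.
  by rewrite -signr_odd oddA expr1.
rewrite (eq_bigr (fun _ => 1%R)) => [|A /andP[_ oddA]].
  by rewrite sumr_const cardsE natz.
by rewrite -signr_odd (negPf oddA).
Qed.

Lemma sum_delta x :
  (\sum_(y | le_state y x) delta phi k y = (level_fun phi k x)%:R)%R.
Proof.
pose Q := [set p in min_path_vectors phi k | le_state p x].
transitivity (- \sum_(A : {set state m} | (A \subset Q) && (A != set0))
                   (-1) ^+ #|A| : int)%R.
  rewrite (eq_bigr _ (fun y _ => delta_sign y)) sumrN; congr (- _)%R.
  (* Group by join: a set of minimal path vectors lies in [Q] iff its join is below [x], so the
     nonempty subsets of [Q] are exactly the formations of the states below [x]. *)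
  rewrite (partition_big (@join_set _ m) (fun y => le_state y x)) /=; last first.
    move=> A /andP[AQ _]; rewrite join_set_le; apply/'forall_in_idP=> a aA.
    by move: (subsetP AQ a aA); rewrite inE => /andP[].
  apply: eq_bigr => y yx; apply: eq_bigl => A; rewrite inE.
  rewrite [y == _]eq_sym.
  have [Ay|_] := eqVneq (join_set A) y; rewrite ?andbF // !andbT andbC.
  congr (_ && _); apply/subsetP/subsetP => AP a aA; last first.
    by move: (AP a aA); rewrite inE => /andP[].
  rewrite inE AP //=; move: yx; rewrite -Ay join_set_le.
  by move/'forall_in_idP; apply.
have sumQ : (\sum_(A : {set state m} | A \subset Q) (-1) ^+ #|A| =
    1 + \sum_(A : {set state m} | (A \subset Q) && (A != set0)) (-1) ^+ #|A|
      :> int)%R.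
  by rewrite (bigD1 set0) ?sub0set //= cards0.
(* [Q] is empty iff [phi x < k]. If so, the sum has no terms; otherwise the alternating sum over all
   subsets is 0, and removing the empty set leaves -1. *)
have [Q0 | Qn0] := eqVneq Q set0.
  suff /negPf-> : ~~ level_fun phi k x.
    rewrite big_pred0 ?oppr0 // => A.
    by rewrite Q0 subset0 andbN.
  apply/negP=> /min_path_vector_below[p pP px].
  by have := in_set0 p; rewrite -Q0 inE pP px.
rewrite sum_subset_sign // in sumQ.
case/set0Pn: Qn0 => p; rewrite !inE => /andP[/andP[kp _] px].
rewrite /level_fun (leq_trans kp (struct_fun_le px)).
by apply/eqP; rewrite eq_sym -subr_eq0 opprK -sumQ.
Qed.

End Delta.

Section Fix.
Variables (C : finType) (m : C -> nat) (e : C).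
Local Notation m' := (@m_others C m e).

Lemma le_extend (r s : 'I_(m e).+1) (y z : state m') :
  le_state (extend s z) (extend r y) = (s <= r) && le_state z y.
Proof.
apply/forallP/andP => [le_ext | [sr /forallP zy] i].
  split; first by move: (le_ext e); rewrite !extend_e.
  by apply/forallP=> i; move: (le_ext (val i)); rewrite !extend_val.
have [-> | ie] := eqVneq i e; first by rewrite !extend_e.
by rewrite -[i]/(val (Sub i ie : others e)) !extend_val zy.
Qed.

Lemma extend_surj (x : state m) :
  extend (x e) ([ffun i : others e => x (val i)] : state m') = x.
Proof.
apply/ffunP=> i; have [-> | ie] := eqVneq i e; first by rewrite extend_e.
by rewrite -[i]/(val (Sub i ie : others e)) extend_val ffunE.
Qed.

Lemma extend_inj (r s : 'I_(m e).+1) (y z : state m') :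
  extend s z = extend r y -> s = r /\ z = y.
Proof.
move=> E; split; first by rewrite -(extend_e s z) E extend_e.
by apply/ffunP=> i; rewrite -(extend_val s z) E extend_val.
Qed.

Lemma extend_top :
  extend (ord_max : 'I_(m e).+1) (top_state m') = top_state m.
Proof.
by rewrite -[RHS]extend_surj; congr extend; last apply/ffunP=> i; rewrite !ffunE.
Qed.

Variables (M : nat) (phi : mms m M) (k : nat).

Lemma delta_fix_component (r : 'I_(m e).+1) (y : state m') :
  (delta (fix_component phi k r) 1 y =
   \sum_(s : 'I_(m e).+1 | (s <= r)%N) delta phi k (extend s y))%R.
Proof.
(* It suffices to compare sums over down-sets. The states below [extend r y] are the [extend s z]
   with [s <= r] and [z] below [y], so both sums equal [phi_k] at [extend r y]. *)
move: y; apply: moebius_uniq => y.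
rewrite sum_delta exchange_big /= pair_big /=.
have -> : level_fun (fix_component phi k r) 1 y = level_fun phi k (extend r y).
  by rewrite {1}/level_fun /= /fix_fun inordK; case: (level_fun phi k _).
rewrite -sum_delta.
rewrite (reindex (fun p : 'I_(m e).+1 * state m' => extend p.1 p.2)) /=.
  by apply: eq_bigl => -[s z]; rewrite le_extend.
exists (fun x => (x e, [ffun i : others e => x (val i)] : state m')).
  by move=> [s z] _ /=; case: (extend_inj (extend_surj (extend s z))) => -> ->.
by move=> x _; apply: extend_surj.
Qed.

End Fix.

Theorem theorem4p4 (C : finType) (m : C -> nat) (M : nat) (phi : mms m M)
    (k : nat) (e : C)
    (hm : forall i : C, 1 <= m i) (hk : 1 <= k <= M) :
  signed_domination phi k =
    (signed_domination (fix_component phi k (ord_max : 'I_(m e).+1)) 1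
     - signed_domination (fix_component phi k (inord (m e - 1) : 'I_(m e).+1)) 1)%R.
Proof.
rewrite /signed_domination !delta_fix_component.
rewrite (bigD1 ord_max) //= extend_top.
(* The indices other than [ord_max] are those up to [m e - 1], so the rest of the first sum cancels
   the second one. *)
rewrite [X in (_ + X - _)%R](eq_bigl (fun s : 'I_(m e).+1 => s <= m e - 1)).
  by rewrite inordK ?addrK // ltnS leq_subr.
move=> s; rewrite -val_eqE /= andbC -ltn_neqAle.
(* [hm e] ensures that the truncated subtraction [m e - 1] is a true predecessor. *)
by rewrite subn1 -[in RHS]ltnS (prednK (hm e)).
Qed.
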